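(* Consider a relative equilibrium of a spherical body and an axially symmetric body ($N=2$, $m=1$), with relative position $\mathbf q=(x,y,z)$, symmetry axis $\mathbf a=(u,v,w)$ and rotation vector $\omega\,\mathbf e_3$, $\omega\ne0$. Suppose that $\mathbf q,\mathbf a,\mathbf e_3$ span a two-dimensional space and that no two of these three vectors are parallel, so that $(x,y)=\lambda(u,v)$ for some $\lambda\in\mathbb R$ and $z\neq\lambda w$. Then $$\lambda\,m_{12}\,z-\frac{k_1}{\omega}\,w=0.$$ In particular, non-Lagrangian equilibria of this kind occur only for $z=\dfrac{k_1\,w}{\lambda\,\omega\,m_{12}}$.
   Context: The bodies have masses $m_1,m_2$ and $m_{12}=m_1m_2/(m_1+m_2)$. $\mathbf q\in\mathbb R^3$ is the relative position vector of the two bodies, $\mathbf a\in\mathbb R^3$ the unit symmetry axis of the axially symmetric body in the spatial frame, with principal moments of inertia $\Theta_{11},\Theta_{11},\Theta_{13}$; $\mathbf e_3=(0,0,1)^T$; $k_1=\omega(\Theta_{13}-\Theta_{11})$. By $O(3)$-invariance the potential is a function $\tilde V$ of $q_{22}=\mathbf q\cdot\mathbf q$ and $\nu_{21}=\mathbf q\cdot\mathbf a$; here $a_{22}=\partial\tilde V/\partial q_{22}$ and $b_{21}=\partial\tilde V/\partial\nu_{21}$, evaluated at the configuration. The configuration $(\mathbf q,\mathbf a)$ is a relative equilibrium (rigid rotation of all vectors about $\mathbf e_3$ with angular velocity $\omega$) when for some constant $\mu_1\in\mathbb R$ $$2a_{22}\,\mathbf q+b_{21}\,\mathbf a=\omega^2m_{12}\,(x,y,0)^T,\qquad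 b_{21}\,\mathbf q+\mu_1\,\mathbf a=\omega\,k_1\,w\,\mathbf e_3.$$ A relative equilibrium is non-Lagrangian if the centers of mass of the bodies move in different parallel planes (here, $z\neq0$). *)

(* Defs.v *)
From HB Require Import structures.
From mathcomp Require Import all_boot all_order all_algebra.
From mathcomp Require Import all_classical all_reals all_analysis.

Set Implicit Arguments.
Unset Strict Implicit.
Unset Printing Implicit Defensive.

Import Order.TTheory GRing.Theory Num.Theory.
Import numFieldNormedType.Exports.

Local Open Scope ring_scope.

Section TwoBodies.
Variable R : realType.

Definition vec3 (x y z : R) : 'rV[R]_3 := \row_(i < 3) [:: x; y; z]`_i.

Definition e3 : 'rV[R]_3 := vec3 0 0 1.

Definition dot (p r : 'rV[R]_3) : R := \sum_(i < 3) p 0 i * r 0 i.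

(* In particular, the zero vector is parallel to every vector. *)
Definition parallel (p r : 'rV[R]_3) : Prop :=
  exists c : R, p = c *: r \/ r = c *: p.

Definition reduced_mass (m1 m2 : R) : R := m1 * m2 / (m1 + m2).

Definition k1 (omega Theta11 Theta13 : R) : R := omega * (Theta13 - Theta11).

(* The reduced potential V is a function of q22 = q.q and nu21 = q.a, in this
   order. *)
Definition has_partials (V : R -> R -> R) (q a : 'rV[R]_3) : Prop :=
  derivable (fun s : R => V s (dot q a)) (dot q q) 1 /\
  derivable (V (dot q q)) (dot q a) 1.

Definition a22 (V : R -> R -> R) (q a : 'rV[R]_3) : R :=
  derive1 (fun s : R => V s (dot q a)) (dot q q).

Definition b21 (V : R -> R -> R) (q a : 'rV[R]_3) : R :=
  derive1 (V (dot q q)) (dot q a).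

(* The coordinates of q are q 0 0, q 0 1 and q 0 2 (row index first). *)
Definition relative_equilibrium (V : R -> R -> R)
    (m1 m2 Theta11 Theta13 omega : R) (q a : 'rV[R]_3) : Prop :=
  exists mu1 : R,
    (2 * a22 V q a) *: q + b21 V q a *: a
      = (omega ^+ 2 * reduced_mass m1 m2) *: vec3 (q 0 0) (q 0 1) 0
    /\ b21 V q a *: q + mu1 *: a
      = (omega * k1 omega Theta11 Theta13 * a 0 2) *: e3.

(* Both centers of mass move in planes orthogonal to e3; these planes are
   different when the relative position q has a nonzero third coordinate. *)
Definition non_lagrangian (q : 'rV[R]_3) : Prop := q 0 2 != 0.

End TwoBodies.

Arguments e3 {R}.

(* Main.v *)
Require Import Defs.
From HB Require Import structures.
From mathcomp Require Import all_boot all_order all_algebra.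
From mathcomp Require Import all_classical all_reals all_analysis.
From mathcomp Require Import ring.

Set Implicit Arguments.
Unset Strict Implicit.
Unset Printing Implicit Defensive.

Import Order.TTheory GRing.Theory Num.Theory.
Import numFieldNormedType.Exports.

Local Open Scope ring_scope.

(** Since [a] and [e3] are independent, coplanarity puts [q] in their span:
    [q = lambda *: a + t *: e3] ([planar_decomposition]).  The horizontal parts
    of [q] and [a] are therefore proportional, and as the one of [a] is nonzero
    it can be cancelled from the horizontal components of the two equilibrium
    equations.  With [A = 2 a22], [B = b21], [W = omega^2 m12] and
    [K = omega k1] this leaves four scalar equations,
    [lambda A + B = lambda W], [A z + B w = 0], [lambda B + mu1 = 0] and
    [B z + mu1 w = K w].  Eliminating [mu1] and replacing [B w] by [- A z] gives
    [K w = B z - lambda B w = (B + lambda A) z = lambda W z]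
    ([planar_balance]); division by [omega^2] yields the claim.  The inequalities
    [lambda != 0] and [z != lambda w] express that [q] is parallel neither to
    [e3] nor to [a]. *)

Lemma vec3_inj (R : realType) (x y z x' y' z' : R) :
  vec3 x y z = vec3 x' y' z' -> [/\ x = x', y = y' & z = z'].
Proof.
move=> /rowP e; split.
- by have := e 0; rewrite !mxE.
- by have := e 1; rewrite !mxE.
- by have := e (inord 2); rewrite !mxE inordK.
Qed.

Lemma vec3D (R : realType) (x y z x' y' z' : R) :
  vec3 x y z + vec3 x' y' z' = vec3 (x + x') (y + y') (z + z').
Proof. by apply/rowP => -[[|[|[|//]]] ?]; rewrite !mxE. Qed.

Lemma vec3Z (R : realType) (c x y z : R) :
  c *: vec3 x y z = vec3 (c * x) (c * y) (c * z).
Proof. by apply/rowP => -[[|[|[|//]]] ?]; rewrite !mxE. Qed.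

Lemma vec3_coord (R : realType) (x y z : R) :
  [/\ vec3 x y z 0 0 = x, vec3 x y z 0 1 = y & vec3 x y z 0 2 = z].
Proof. by split; rewrite mxE. Qed.

(** The family [q, a, e] has more vectors than the dimension of its span, so it
    is not free; as [a, e] is free, [q] is the dependent vector. *)
Lemma planar_decomposition (R : realType) (q a e : 'rV[R]_3) :
  \dim <<[:: q; a; e]>>%VS = 2%N -> ~ parallel a e ->
  exists lambda t : R, q = lambda *: a + t *: e.
Proof.
move=> dim2 a_npar_e.
have dep : ~~ free [:: q; a; e] by rewrite /free dim2.
have indep : free [:: a; e].
  rewrite free_cons seq1_free span_seq1; apply/andP; split.
    by apply/negP => /vlineP[c ac]; apply: a_npar_e; exists c; left.
  apply/eqP => e0; apply: a_npar_e.
  by exists 0; right; rewrite scale0r.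
move: dep; rewrite free_cons indep andbT negbK span_cons span_seq1.
by case/memv_addP => _ /vlineP[l ->] [_ /vlineP[t ->] ->]; exists l, t.
Qed.

(** Adding [lambda] times the vertical force equation and subtracting [w] times
    the horizontal torque equation turns the left-hand side of the vertical
    torque equation into [(lambda * A + B) * z]. *)
Lemma planar_balance (R : comPzRingType) (A B W K mu lambda z w : R) :
  lambda * A + B = lambda * W -> A * z + B * w = 0 ->
  lambda * B + mu = 0 -> B * z + mu * w = K * w ->
  lambda * W * z = K * w.
Proof.
move=> force_h force_v torque_h torque_v.
rewrite -torque_v -force_h.
transitivity (B * z + mu * w + lambda * (A * z + B * w)
              - (lambda * B + mu) * w); first by ring.
by rewrite force_v torque_h; ring.
Qed.

(** The same balance with the horizontal equations in components, one of which
    can be divided by the nonzero coordinate of the horizontal part [(u, v)]. *)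
Lemma planar_balance_coord (R : realType)
    (A B W K mu lambda u v z w : R) :
  (u != 0) || (v != 0) ->
  A * (lambda * u) + B * u = W * (lambda * u) ->
  A * (lambda * v) + B * v = W * (lambda * v) ->
  A * z + B * w = 0 ->
  B * (lambda * u) + mu * u = 0 ->
  B * (lambda * v) + mu * v = 0 ->
  B * z + mu * w = K * w ->
  lambda * W * z = K * w.
Proof.
move=> uv_neq0 force_u force_v force_z torque_u torque_v torque_z.
have cancel h : h != 0 -> A * (lambda * h) + B * h = W * (lambda * h) ->
    B * (lambda * h) + mu * h = 0 -> lambda * W * z = K * w.
  move=> h_neq0 force_h torque_h.
  apply: (planar_balance _ force_z _ torque_z); apply: (mulIf h_neq0).
    by transitivity (A * (lambda * h) + B * h); [ring | rewrite force_h; ring].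
  by rewrite mul0r -torque_h; ring.
by case/orP: uv_neq0 => /cancel; apply.
Qed.

Theorem mainTheorem8 (R : realType) (V : R -> R -> R)
    (m1 m2 Theta11 Theta13 omega : R) (x y z u v w : R) (q a : 'rV[R]_3)
    (hm1 : 0 < m1) (hm2 : 0 < m2) (homega : omega != 0)
    (hq : q = vec3 x y z) (ha : a = vec3 u v w)
    (ha_unit : dot a a = 1)
    (hV : has_partials V q a)
    (heq : relative_equilibrium V m1 m2 Theta11 Theta13 omega q a)
    (hspan : \dim <<[:: q; a; e3]>>%VS = 2%N)
    (hqa : ~ parallel q a) (hqe : ~ parallel q e3) (hae : ~ parallel a e3) :
  exists lambda : R,
    [/\ x = lambda * u /\ y = lambda * v,
        lambda != 0,
        z != lambda * w,
        lambda * reduced_mass m1 m2 * z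
          - k1 omega Theta11 Theta13 / omega * w = 0 &
        non_lagrangian q ->
          z = k1 omega Theta11 Theta13 * w
                / (lambda * omega * reduced_mass m1 m2)].
Proof.
have [lambda [t q_dec]] := planar_decomposition hspan hae.
have [xE yE _] : [/\ x = lambda * u, y = lambda * v & z = lambda * w + t].
  move: q_dec; rewrite hq ha /e3 !vec3Z vec3D => /vec3_inj[-> -> ->].
  by rewrite !mulr0 !addr0 mulr1.
have lambda_neq0 : lambda != 0.
  apply/eqP => l0; apply: hqe; exists t; left.
  by rewrite q_dec l0 scale0r add0r.
have z_neq : z != lambda * w.
  apply/eqP => zE; apply: hqa; exists lambda; left.
  by rewrite hq ha vec3Z xE yE zE.
have uv_neq0 : (u != 0) || (v != 0).
  rewrite -negb_and; apply/negP => /andP[/eqP u0 /eqP v0].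
  by apply: hae; exists w; left; rewrite ha u0 v0 /e3 vec3Z !mulr0 mulr1.
have m12_neq0 : reduced_mass m1 m2 != 0.
  by rewrite lt0r_neq0 // divr_gt0 ?mulr_gt0 ?addr_gt0.
case: heq => mu [].
move: (a22 V q a) (b21 V q a) => A B.
have [q0 q1 _] := vec3_coord x y z; have [_ _ a2] := vec3_coord u v w.
rewrite hq ha q0 q1 a2 /e3 !vec3Z !vec3D !mulr0 mulr1 xE yE.
move=> /vec3_inj[force_x force_y force_z] /vec3_inj[torque_x torque_y torque_z].
have balance : lambda * (omega ^+ 2 * reduced_mass m1 m2) * z
    = omega * k1 omega Theta11 Theta13 * w.
  exact: (planar_balance_coord uv_neq0 force_x force_y force_z
            torque_x torque_y torque_z).
have balance1 : k1 omega Theta11 Theta13 * w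
    = lambda * omega * reduced_mass m1 m2 * z.
  by apply: (mulfI homega); rewrite mulrA -balance; ring.
exists lambda; split => //.
- by rewrite (mulrAC (k1 omega Theta11 Theta13)) balance1; field.
- by move=> _; rewrite balance1; field; rewrite m12_neq0 homega lambda_neq0.
Qed.
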